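(* Let $\alpha\neq 0$ be a real number and let $\vec v\in\mathbb R_1^3$. If $\Sigma\subset\mathbb R_1^3$ is a spacelike surface of revolution with timelike rotation axis that is a $K^\alpha$-translator with speed $\vec v$, then $\vec v$ is parallel to the rotation axis of $\Sigma$.
   Context: $\mathbb R_1^3$ is $\mathbb R^3$ with the metric $\langle,\rangle=dx^2+dy^2-dz^2$. A surface is spacelike if its induced metric is Riemannian; then its unit normal $N$ satisfies $\langle N,N\rangle=\epsilon=-1$. The Gauss curvature is $K=\epsilon\det(A)$, where $AU=-\nabla^0_U N$ is the Weingarten map and $\nabla^0$ is the Levi-Civita connection of $\mathbb R_1^3$. In a local parametrization $X(u,v)$, $$K=-\frac{\det(X_u,X_v,X_{uu})\det(X_u,X_v,X_{vv})-\det(X_u,X_v,X_{uv})^2}{(EG-F^2)^2},$$ where $E=\langle X_u,X_u\rangle$, $F=\langle X_u,X_v\rangle$, $G=\langle X_v,X_v\rangle$. A spacelike surface is a $K^\alpha$-translator with speed $\vec v$ if $K>0$ and $K^\alpha=\langle N,\vec v\rangle$ everywhere, for a choice of unit normal $N$. A surface of revolution with timelike axis is, after a rigid motion of $\mathbb R_1^3$, one whose axis is the $z$-axis, parametrized by $X(r,\theta)=(r\cos\theta,r\sin\theta,f(r))$ with $f$ smooth on an interval of $r>0$; it is spacelike iff $f'^2<1$. *)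

(* Defs.v *)
From mathcomp Require Import all_boot all_order all_algebra.
From mathcomp Require Import all_classical all_reals all_analysis.
Set Implicit Arguments.
Unset Strict Implicit.
Unset Printing Implicit Defensive.
Import Order.TTheory GRing.Theory Num.Theory.
Import numFieldNormedType.Exports.
Local Open Scope classical_set_scope.
Local Open Scope ring_scope.

Definition vec3 (R : realType) (x y z : R) : 'rV[R]_3 :=
  \row_k [:: x; y; z]`_k.

Definition lorentz (R : realType) (x y : 'rV[R]_3) : R :=
  x 0 0 * y 0 0 + x 0 1 * y 0 1
  - x 0 2 * y 0 2.

(* The rigid motions of Minkowski space are the maps x |-> x *m L + b with L a
   linear isometry of the Lorentzian metric. *)
Definition linear_isometry (R : realType) (L : 'M[R]_3) : Prop :=
  forall x y : 'rV[R]_3, lorentz (x *m L) (y *m L) = lorentz x y.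

(* In what follows X : 'rV[R]_2 -> 'rV[R]_3 is a surface parametrized over
   the open set D.  Vectors are rows, so the rows of 'J X p are the partial
   derivatives X_u and X_v at p, and w *m 'J X p is the tangent vector with
   coordinates w. *)

Definition spacelike (R : realType) (X : 'rV[R]_2 -> 'rV[R]_3)
    (D : set 'rV[R]_2) : Prop :=
  forall p, D p -> forall w : 'rV[R]_2, w != 0 ->
    0 < lorentz (w *m 'J X p) (w *m 'J X p).

(* Normalized to -1, the sign forced on a spacelike surface. *)
Definition unit_normal (R : realType) (X : 'rV[R]_2 -> 'rV[R]_3)
    (D : set 'rV[R]_2) (N : 'rV[R]_2 -> 'rV[R]_3) : Prop :=
  forall p, D p ->
    [/\ differentiable N p,
        lorentz (N p) (N p) = -1 &
        forall w : 'rV[R]_2, lorentz (N p) (w *m 'J X p) = 0].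

(* The Levi-Civita connection of the ambient space is flat, so the Weingarten
   map U |-> - nabla_U N sends w *m 'J X p to - (w *m 'J N p).  Its matrix A in
   the basis (X_u, X_v), acting on row coordinates, is thus the solution of
   A *m 'J X p = - 'J N p, which is unique because 'J X p is row_free. *)
Definition weingarten (R : realType) (X N : 'rV[R]_2 -> 'rV[R]_3)
    (p : 'rV[R]_2) : 'M[R]_2 :=
  - 'J N p *m pinvmx ('J X p).

(* K = epsilon * det A with epsilon = <N, N>, which is -1 here. *)
Definition gauss_curvature (R : realType) (X N : 'rV[R]_2 -> 'rV[R]_3)
    (p : 'rV[R]_2) : R :=
  lorentz (N p) (N p) * \det (weingarten X N p).

Definition K_translator (R : realType) (alpha : R) (v : 'rV[R]_3)
    (X : 'rV[R]_2 -> 'rV[R]_3) (D : set 'rV[R]_2) : Prop :=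
  exists2 N, unit_normal X D N &
    forall p, D p ->
      0 < gauss_curvature X N p /\
      gauss_curvature X N p `^ alpha = lorentz (N p) v.

Definition smooth_on (R : realType) (I : set R) (f : R -> R) : Prop :=
  forall (n : nat) (r : R), I r -> derivable (derive1n n f) r 1.

(* The coordinates of p are (r, theta); theta ranges over all of R. *)
Definition revolution_domain (R : realType) (I : set R) : set 'rV[R]_2 :=
  [set p | I (p 0 0)].

Definition revolution_z (R : realType) (f : R -> R) (p : 'rV[R]_2) : 'rV[R]_3 :=
  vec3 (p 0 0 * cos (p 0 1)) (p 0 0 * sin (p 0 1)) (f (p 0 0)).

(* Image under x |-> x *m L + b of the surface of revolution about the z-axis;
   its axis is the line through b directed by vec3 0 0 1 *m L. *)
Definition revolution (R : realType) (L : 'M[R]_3) (b : 'rV[R]_3) (f : R -> R)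
    (p : 'rV[R]_2) : 'rV[R]_3 :=
  revolution_z f p *m L + b.

Definition revolution_axis (R : realType) (L : 'M[R]_3) (b : 'rV[R]_3) :
    set 'rV[R]_3 :=
  [set vec3 0 0 t *m L + b | t in [set: R]].

Definition parallel (R : realType) (v : 'rV[R]_3) (l : set 'rV[R]_3) : Prop :=
  forall p q, l p -> l q -> p != q -> exists c : R, v = c *: (q - p).

(* Main.v *)
Require Import Defs.
From mathcomp Require Import all_boot all_order all_algebra.
From mathcomp Require Import all_classical all_reals all_analysis.
From mathcomp Require Import ring lra.
Import Order.TTheory GRing.Theory Num.Theory.
Import numFieldNormedType.Exports.
Local Open Scope classical_set_scope.
Local Open Scope ring_scope.

(* In coordinates (r, theta) the unit normal is
   N = z (f' cos theta, f' sin theta, 1) with z^2 = 1 / (1 - f'^2), and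
   differentiating gives N_r = f'' z^3 X_r and N_theta = (f' z / r) X_theta,
   so K = - f' f'' / (r (1 - f'^2)^2) does not depend on theta and K > 0 forces
   f' != 0.  At a fixed r the translator equation then says that
   (f' (v_1 cos theta + v_2 sin theta) - v_3)^2 is a nonzero constant in theta,
   which forces v_1 = v_2 = 0.  Squaring makes the sign of z irrelevant. *)

(** * Coordinates of row vectors of length three *)

Lemma ord3P (j : 'I_3) : [\/ j = 0, j = 1 | j = 2].
Proof.
by case: j => [[|[|[|//]]] jlt];
  [constructor 1|constructor 2|constructor 3]; apply: val_inj.
Qed.

Lemma vec3E0 (R : realType) (x y z : R) : vec3 x y z 0 0 = x.
Proof. by rewrite mxE. Qed.

Lemma vec3E1 (R : realType) (x y z : R) : vec3 x y z 0 1 = y.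
Proof. by rewrite mxE. Qed.

Lemma vec3E2 (R : realType) (x y z : R) : vec3 x y z 0 2 = z.
Proof. by rewrite mxE. Qed.

Definition vec3E := (vec3E0, vec3E1, vec3E2).

Lemma vec3_eta (R : realType) (u : 'rV[R]_3) :
  u = vec3 (u 0 0) (u 0 1) (u 0 2).
Proof.
by apply/rowP => j; case: (ord3P j) => ->; rewrite vec3E.
Qed.

(** * Coordinatewise calculus of row-valued maps and their Jacobians *)

Lemma differentiable_rV (R : realType) (V : normedModType R) n
    (X : V -> 'rV[R]_n) (p : V) :
  (forall j, differentiable (fun q => X q 0 j) p) -> differentiable X p.
Proof.
move=> dX.
have -> : X = \sum_j (fun q => X q 0 j *: (delta_mx 0 j : 'rV[R]_n)).
  by apply/funext => q; rewrite fct_sumE [LHS]row_sum_delta.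
by apply: differentiable_sum => j; apply: differentiableZl.
Qed.

Lemma mul_jacobianE (R : realType) m n (X : 'rV[R]_m.+1 -> 'rV[R]_n.+1)
    (p w : 'rV[R]_m.+1) j :
  differentiable X p -> (w *m 'J X p) 0 j = 'D_w (fun q => X q 0 j) p.
Proof.
move=> dX; rewrite -deriveEjacobian // derive_mx ?mxE //.
exact: diff_derivable.
Qed.

Lemma is_derive_coord (R : realType) m n (X : 'rV[R]_m.+1 -> 'rV[R]_n.+1)
    (p w : 'rV[R]_m.+1) j :
  differentiable X p -> is_derive p w (fun q => X q 0 j) ((w *m 'J X p) 0 j).
Proof.
move=> dX; rewrite mul_jacobianE //; apply/derivableP.
by apply: (iffLR (derivable_mxP _ _ _)); exact: diff_derivable.
Qed.

(** Each coordinate is put in the form of a sum of products of functions, to which the sum and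
    product rules apply directly. *)
Lemma affineE (R : realType) m n k (X : 'rV[R]_m.+1 -> 'rV[R]_n.+1)
    (L : 'M[R]_(n.+1, k.+1)) (b : 'rV[R]_k.+1) j :
  (fun q => (X q *m L + b) 0 j) =
    \sum_i ((fun q => X q 0 i) * cst (L i j)) + cst (b 0 j).
Proof.
apply/funext => q; rewrite mxE mxE fctE fct_sumE; congr (_ + _).
Qed.

Lemma differentiable_affine (R : realType) m n k
    (X : 'rV[R]_m.+1 -> 'rV[R]_n.+1) (L : 'M[R]_(n.+1, k.+1))
    (b : 'rV[R]_k.+1) (p : 'rV[R]_m.+1) :
  differentiable X p -> differentiable (fun q => X q *m L + b) p.
Proof.
move=> dX; apply: differentiable_rV => j; rewrite affineE.
apply: differentiableD => //; apply: differentiable_sum => i.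
apply: differentiableM => //.
exact: (differentiable_comp dX (differentiable_coord _ _ _)).
Qed.

Lemma jacobian_affine (R : realType) m n k
    (X : 'rV[R]_m.+1 -> 'rV[R]_n.+1) (L : 'M[R]_(n.+1, k.+1))
    (b : 'rV[R]_k.+1) (p : 'rV[R]_m.+1) :
  differentiable X p -> 'J (fun q => X q *m L + b) p = 'J X p *m L.
Proof.
move=> dX; apply/row_matrixP => i; rewrite !rowE mulmxA.
apply/rowP => j; rewrite mul_jacobianE; last exact: differentiable_affine.
set w := delta_mx 0 i.
rewrite affineE [RHS]mxE.
have dXi l : is_derive p w (fun q => X q 0 l) ((w *m 'J X p) 0 l).
  exact: is_derive_coord.
have dsum := is_derive_sum
  (fun l => is_deriveM (dXi l) (is_derive_cst (L l j) p w)).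
have [_ ->] := is_deriveD dsum (is_derive_cst (b 0 j) p w).
rewrite addr0; apply: eq_bigr => l _.
by rewrite scaler0 add0r /= mulrC.
Qed.

(** Chain rule: the coordinate [q 0 i] is linear, so its derivative along [w] is [w 0 i]. *)
Lemma is_derive_comp_coord (R : realType) m (g : R -> R) (dg : R)
    (p w : 'rV[R]_m.+1) i :
  is_derive (p 0 i) 1 g dg -> is_derive p w (fun q => g (q 0 i)) (w 0 i * dg).
Proof.
move=> [/derivable1_diffP Dg <-].
have Dc : differentiable (fun q : 'rV[R]_m.+1 => q 0 i) p.
  exact: differentiable_coord.
have D : differentiable (g \o (fun q : 'rV[R]_m.+1 => q 0 i)) p.
  exact: differentiable_comp.
apply: DeriveDef; first exact: (diff_derivable D).
rewrite -[LHS]/('D_w (g \o (fun q : 'rV[R]_m.+1 => q 0 i)) p).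
rewrite deriveE // diff_comp //= diff1E // derive1E; congr (_ * _).
rewrite -deriveE //.
have := derive_mx (@derivable_id _ _ p w).
by rewrite derive_id => /(congr1 (fun M : 'rV[R]_m.+1 => M 0 i)); rewrite mxE.
Qed.

(** * Lorentzian isometries and first derivatives of the surface of revolution *)

(** A vector killed by [L] is orthogonal to every vector, hence zero because the Lorentzian form is
    nondegenerate: pairing with the standard basis reads off its coordinates up to sign. *)
Lemma linear_isometry_unit (R : realType) (L : 'M[R]_3) :
  linear_isometry L -> L \in unitmx.
Proof.
move=> hL; rewrite -row_free_unit; apply/inj_row_free => x xL0.
have x0 y : lorentz x y = 0.
  by rewrite -hL xL0 /lorentz !mxE; ring.
rewrite [x]vec3_eta.
have := (x0 (vec3 1 0 0), x0 (vec3 0 1 0), x0 (vec3 0 0 1)).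
rewrite /lorentz !vec3E => -[[h0 h1] h2].
apply/rowP => j; case: (ord3P j) => ->; rewrite vec3E mxE; lra.
Qed.

Lemma is_derive_derive1 (R : realType) (g : R -> R) (x : R) :
  derivable g x 1 -> is_derive x 1 g (derive1 g x).
Proof. by move=> dg; rewrite derive1E; apply/derivableP. Qed.

Lemma is_derive_revolution_z (R : realType) (f : R -> R) (p w : 'rV[R]_2) j :
  derivable f (p 0 0) 1 ->
  is_derive p w (fun q => revolution_z f q 0 j)
    (vec3 (w 0 0 * cos (p 0 1) - w 0 1 * (p 0 0 * sin (p 0 1)))
          (w 0 0 * sin (p 0 1) + w 0 1 * (p 0 0 * cos (p 0 1)))
          (w 0 0 * derive1 f (p 0 0)) 0 j).
Proof.
move=> /is_derive_derive1 df.
have dr : is_derive p w (fun q : 'rV[R]_2 => q 0 0) (w 0 0 * 1).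
  exact: (@is_derive_comp_coord _ _ id).
have dc : is_derive p w (fun q : 'rV[R]_2 => cos (q 0 1)) _ :=
  is_derive_comp_coord _ _ _ _ p w 1 (is_derive_cos (p 0 1)).
have ds : is_derive p w (fun q : 'rV[R]_2 => sin (q 0 1)) _ :=
  is_derive_comp_coord _ _ _ _ p w 1 (is_derive_sin (p 0 1)).
case: (ord3P j) => ->; rewrite vec3E.
- under eq_fun do rewrite vec3E.
  by apply: (is_derive_eq (is_deriveM dr dc)); rewrite /GRing.scale /=; ring.
- under eq_fun do rewrite vec3E.
  by apply: (is_derive_eq (is_deriveM dr ds)); rewrite /GRing.scale /=; ring.
- under eq_fun do rewrite vec3E.
  exact: is_derive_comp_coord.
Qed.

Lemma differentiable_revolution_z (R : realType) (f : R -> R) (p : 'rV[R]_2) :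
  derivable f (p 0 0) 1 -> differentiable (revolution_z f) p.
Proof.
move=> /derivable1_diffP df; apply: differentiable_rV => j.
have dc i : differentiable (fun q : 'rV[R]_2 => q 0 i) p.
  exact: differentiable_coord.
have D (g : R -> R) i : derivable g (p 0 i) 1 ->
    differentiable (fun q : 'rV[R]_2 => g (q 0 i)) p.
  by move=> /derivable1_diffP dg; exact: (differentiable_comp (dc i) dg).
case: (ord3P j) => ->; under eq_fun do rewrite vec3E.
- by apply: differentiableM => //; apply: (D cos).
- by apply: differentiableM => //; apply: (D sin).
- by apply: (D f); apply/derivable1_diffP.
Qed.

Lemma mul_jacobian_revolution (R : realType) (L : 'M[R]_3) (b : 'rV[R]_3)
    (f : R -> R) (p w : 'rV[R]_2) :
  derivable f (p 0 0) 1 ->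
  w *m 'J (revolution L b f) p =
    vec3 (w 0 0 * cos (p 0 1) - w 0 1 * (p 0 0 * sin (p 0 1)))
         (w 0 0 * sin (p 0 1) + w 0 1 * (p 0 0 * cos (p 0 1)))
         (w 0 0 * derive1 f (p 0 0)) *m L.
Proof.
move=> df; have dX := differentiable_revolution_z _ _ _ df.
rewrite /revolution jacobian_affine // mulmxA; congr (_ *m L).
apply/rowP => j; rewrite mul_jacobianE //.
by have [_ ->] := is_derive_revolution_z _ _ _ w j df.
Qed.

(** * The unit normal of a surface of revolution *)

(** Here [c], [s] stand for cos theta, sin theta and [d] for f'; the last two hypotheses are
    orthogonality to X_r and to X_theta / r. In the orthonormal frame (c, s), (-s, c) of the plane,
    (x, y) therefore has components d z and 0. *)
Lemma revolution_normalE (R : realType) (d c s x y z : R) :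
    c ^+ 2 + s ^+ 2 = 1 ->
    x ^+ 2 + y ^+ 2 - z ^+ 2 = -1 ->
    x * c + y * s - z * d = 0 -> y * c - x * s = 0 ->
  [/\ x = d * c * z, y = d * s * z & z ^+ 2 * (1 - d ^+ 2) = 1].
Proof.
move=> cs1 N1 Nr Nt.
have xE : x = d * c * z.
  rewrite -[x]mulr1 -cs1.
  have -> : x * (c ^+ 2 + s ^+ 2) =
      c * (x * c + y * s - z * d) - s * (y * c - x * s) + d * c * z by ring.
  by rewrite Nr Nt; ring.
have yE : y = d * s * z.
  rewrite -[y]mulr1 -cs1.
  have -> : y * (c ^+ 2 + s ^+ 2) =
      s * (x * c + y * s - z * d) + c * (y * c - x * s) + d * s * z by ring.
  by rewrite Nr Nt; ring.
split=> //; transitivity (z ^+ 2 - x ^+ 2 - y ^+ 2); last by lra.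
have -> : d ^+ 2 = d ^+ 2 * (c ^+ 2 + s ^+ 2) by rewrite cs1 mulr1.
by rewrite xE yE; ring.
Qed.

(** Allows an identity valid near [p] to be differentiated on both sides. *)
Lemma near_is_derive_unique (R : realType) (V : normedModType R)
    (f g : V -> R) (p w : V) (df dg : R) :
  {near p, f =1 g} -> is_derive p w f df -> is_derive p w g dg -> df = dg.
Proof.
by move=> fg [_ <-] [_ <-]; exact: near_eq_derive.
Qed.

Lemma revolution_domain_open (R : realType) (I : set R) :
  open I -> open (revolution_domain I).
Proof.
move=> oI; apply: (@open_comp _ _ (fun q : 'rV[R]_2 => q 0 0)) => // q _.
exact: coord_continuous.
Qed.

Lemma revolution_normal (R : realType) (L : 'M[R]_3) (b : 'rV[R]_3)
    (f : R -> R) (D : set 'rV[R]_2) (N : 'rV[R]_2 -> 'rV[R]_3)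
    (p : 'rV[R]_2) (n := N p *m invmx L) :
    linear_isometry L -> unit_normal (revolution L b f) D N -> D p ->
    p 0 0 != 0 -> derivable f (p 0 0) 1 ->
  [/\ n 0 0 = derive1 f (p 0 0) * cos (p 0 1) * n 0 2,
      n 0 1 = derive1 f (p 0 0) * sin (p 0 1) * n 0 2 &
      n 0 2 ^+ 2 * (1 - derive1 f (p 0 0) ^+ 2) = 1].
Proof.
move=> hL hN Dp r0 df; have [_ N1 NX] := hN p Dp.
have NE : N p = n *m L by rewrite mulmxKV // linear_isometry_unit.
have nX w := NX w; move: nX; rewrite NE => nX.
move: N1; rewrite NE hL => n1; clearbody n.
apply: revolution_normalE.
- exact: cos2Dsin2.
- by rewrite -n1 /lorentz; ring.
- have := nX (delta_mx 0 0); rewrite mul_jacobian_revolution // hL.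
  rewrite /lorentz !vec3E !mxE /= => <-; ring.
(* X_theta carries a factor r, which is cancelled by [r0]. *)
- have := nX (delta_mx 0 1); rewrite mul_jacobian_revolution // hL.
  rewrite /lorentz !vec3E !mxE /= => nt; apply: (mulfI r0).
  by rewrite mulr0 -nt; ring.
Qed.

(** * The Weingarten map and the Gauss curvature *)

Lemma spacelike_row_free (R : realType) (X : 'rV[R]_2 -> 'rV[R]_3)
    (D : set 'rV[R]_2) (p : 'rV[R]_2) :
  spacelike X D -> D p -> row_free ('J X p).
Proof.
move=> sX Dp; apply/inj_row_free => w wJ0; apply/eqP; apply: contraT => w0.
by have := sX p Dp w w0; rewrite wJ0 /lorentz !mxE; lra.
Qed.

(* The meridians and the parallels are the lines of curvature. *)
Lemma jacobian_revolution_normal (R : realType) (L : 'M[R]_3) (b : 'rV[R]_3)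
    (f : R -> R) (D : set 'rV[R]_2) (N : 'rV[R]_2 -> 'rV[R]_3)
    (p : 'rV[R]_2) (z := (N p *m invmx L) 0 2) :
    linear_isometry L -> unit_normal (revolution L b f) D N ->
    open D -> D p ->
    (forall q, D q -> q 0 0 != 0 /\ derivable f (q 0 0) 1) ->
    derivable (derive1 f) (p 0 0) 1 ->
  'J N p = diag_mx (\row_i [:: derive1n 2 f (p 0 0) * z ^+ 3;
                               derive1 f (p 0 0) * z / p 0 0]`_i)
           *m 'J (revolution L b f) p.
Proof.
move=> hL hN oD Dp Df ddf; have Lu := linear_isometry_unit _ _ hL.
have [r0 df] := Df p Dp; have [dN _ _] := hN p Dp.
(* The normal is carried back to the surface around the z-axis; [+ 0] gives it the shape of the
   affine lemmas. *)
pose n q := N q *m invmx L + 0.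
have nE q : n q = N q *m invmx L by rewrite /n addr0.
have dn : differentiable n p by exact: differentiable_affine.
have -> : 'J N p = 'J n p *m L by rewrite jacobian_affine // mulmxKV.
(* Since [D] is open, the formulas for the normal hold on a neighbourhood of [p] and can be
   differentiated there. Squares are written as products for the product rule. *)
have nD : \forall q \near p,
  [/\ n q 0 0 = derive1 f (q 0 0) * cos (q 0 1) * n q 0 2,
      n q 0 1 = derive1 f (q 0 0) * sin (q 0 1) * n q 0 2 &
      n q 0 2 * n q 0 2 * (1 - derive1 f (q 0 0) * derive1 f (q 0 0)) = 1].
  have : \forall q \near p, D q by exact: open_nbhs_nbhs.
  apply: filterS => q Dq; have [q0 dq] := Df q Dq.
  by rewrite nE -!expr2; exact: (revolution_normal _ _ _ _ _ _ _ hL hN Dq).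
have [_ _ n2] := nbhs_singleton nD.
apply/row_matrixP => i; rewrite !rowE !mulmxA.
(* The computation is the same for every direction, so the basis vector is generalized to an
   arbitrary [w]. *)
move: (delta_mx 0 i) => w.
rewrite mul_jacobian_revolution // mul_mx_diag !mxE /=.
congr (_ *m L).
have dnj j : is_derive p w (fun q => n q 0 j) ((w *m 'J n p) 0 j).
  exact: is_derive_coord.
have dg : is_derive p w (fun q : 'rV[R]_2 => derive1 f (q 0 0)) _ :=
  is_derive_comp_coord _ _ _ _ p w 0 (is_derive_derive1 _ _ _ ddf).
have dc : is_derive p w (fun q : 'rV[R]_2 => cos (q 0 1)) _ :=
  is_derive_comp_coord _ _ _ _ p w 1 (is_derive_cos (p 0 1)).
have ds : is_derive p w (fun q : 'rV[R]_2 => sin (q 0 1)) _ :=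
  is_derive_comp_coord _ _ _ _ p w 1 (is_derive_sin (p 0 1)).
have zE : z = n p 0 2 by rewrite nE.
set d := derive1 f (p 0 0) in n2 *.
set dd := derive1n 2 f (p 0 0).
have ddE : derive1 (derive1 f) (p 0 0) = dd by [].
(* Differentiating z^2 (1 - f'^2) = 1 along [w] and solving for the derivative of z. *)
have m2 : (w *m 'J n p) 0 2 = w 0 0 * d * dd * z ^+ 3.
  have D1 := is_deriveM (is_deriveM (dnj 2) (dnj 2))
    (is_deriveB (is_derive_cst (1 : R) p w) (is_deriveM dg dg)).
  have D2 := is_derive_cst (1 : R) p w.
  have := near_is_derive_unique _ _ _ _ _ _ _ _ _ D1 D2.
  have eq1 : \forall q \near p, n q 0 2 * n q 0 2 *
      (1 - derive1 f (q 0 0) * derive1 f (q 0 0)) = 1.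
    by apply: filterS nD => q [].
  move=> /(_ eq1).
  rewrite /GRing.scale /= /GRing.mul_fun !fctE ddE -/d -zE.
  rewrite -zE in n2; set m := (_ *m _) 0 2 => e.
  have z0 : z != 0.
    apply/eqP => z0; move: n2; rewrite z0; lra.
  apply: (mulfI z0).
  have -> : z * m = z * z * (1 - d * d) * (z * m) by rewrite n2 mul1r.
  (* The last bracket is the derivative of z^2 (1 - f'^2), which vanishes by [e]. *)
  have -> : z * z * (1 - d * d) * (z * m) =
    z * (w 0 0 * d * dd * z ^+ 3) + z * z / 2 *
    (z * z * (0 - (d * (w 0 0 * dd) + d * (w 0 0 * dd))) +
     (1 - d * d) * (z * m + z * m)) by field.
  by rewrite e mulr0 addr0.
(* This merges the two f'' terms in the derivative of f' z: f'' z + f'^2 f'' z^3 = f'' z^3. *)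
have z3 : z ^+ 3 * (d * d) = z ^+ 3 - z.
  have -> : z ^+ 3 * (d * d) = z ^+ 3 - z * (z * z * (1 - d * d)) by ring.
  by rewrite zE n2 mulr1.
rewrite -ddE in m2 *.
apply/rowP => j; case: (ord3P j) => ->; rewrite vec3E.
- have eq0 : \forall q \near p,
      n q 0 0 = derive1 f (q 0 0) * cos (q 0 1) * n q 0 2.
    by apply: filterS nD => q [].
  have D1 := is_deriveM (is_deriveM dg dc) (dnj 2).
  rewrite (near_is_derive_unique _ _ _ _ _ _ _ _ eq0 (dnj 0) D1).
  rewrite /GRing.scale /= /GRing.mul_fun ?fctE m2 -/d -zE.
  apply/subr0_eq; transitivity (w 0 0 * derive1 (derive1 f) (p 0 0) *
    cos (p 0 1) * (z ^+ 3 * (d * d) + z - z ^+ 3)); first by field.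
  by rewrite z3; ring.
- have eq1 : \forall q \near p,
      n q 0 1 = derive1 f (q 0 0) * sin (q 0 1) * n q 0 2.
    by apply: filterS nD => q [].
  have D1 := is_deriveM (is_deriveM dg ds) (dnj 2).
  rewrite (near_is_derive_unique _ _ _ _ _ _ _ _ eq1 (dnj 1) D1).
  rewrite /GRing.scale /= /GRing.mul_fun ?fctE m2 -/d -zE.
  apply/subr0_eq; transitivity (w 0 0 * derive1 (derive1 f) (p 0 0) *
    sin (p 0 1) * (z ^+ 3 * (d * d) + z - z ^+ 3)); first by field.
  by rewrite z3; ring.
- rewrite m2; ring.
Qed.

Lemma gauss_curvature_revolution (R : realType) (L : 'M[R]_3) (b : 'rV[R]_3)
    (f : R -> R) (I : set R) (N : 'rV[R]_2 -> 'rV[R]_3) (p : 'rV[R]_2) :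
    linear_isometry L ->
    unit_normal (revolution L b f) (revolution_domain I) N ->
    open I -> I (p 0 0) ->
    (forall r, I r -> r != 0) -> smooth_on I f ->
    spacelike (revolution L b f) (revolution_domain I) ->
  gauss_curvature (revolution L b f) N p =
    - (derive1 f (p 0 0) * derive1n 2 f (p 0 0)
       / (p 0 0 * (1 - derive1 f (p 0 0) ^+ 2) ^+ 2)).
Proof.
move=> hL hN oI Ip I0 sf sX.
have dE (r : R) : I r -> derivable f r 1 := sf 0%N r.
have dE1 : derivable (derive1 f) (p 0 0) 1 := sf 1%N (p 0 0) Ip.
have [_ N1 _] := hN p Ip.
have [_ _ z2] := revolution_normal _ _ _ _ _ _ _ hL hN Ip (I0 _ Ip) (dE _ Ip).
rewrite /gauss_curvature N1 /weingarten.
rewrite (jacobian_revolution_normal _ _ _ _ _ _ _ hL hN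
  (revolution_domain_open _ _ oI) Ip) //; last first.
  by move=> q Iq; split; [exact: I0|exact: dE].
(* The Jacobian is row free, so the pseudo-inverse cancels it and the Weingarten matrix is minus the
   diagonal one. *)
rewrite -mulNmx mulmxKp; last exact: spacelike_row_free sX Ip.
move: z2; set z := (_ *m _) 0 2 => z2.
have z0 : z != 0 by apply/eqP => z0; move: z2; rewrite z0; lra.
(* Both sides become - f' f'' z^4 / r. *)
have -> : 1 - derive1 f (p 0 0) ^+ 2 = (z ^+ 2)^-1.
  by apply: (mulfI (expf_neq0 2 z0)); rewrite z2 divff ?expf_neq0.
clearbody z; have := I0 _ Ip.
move: (p 0 0) (derive1 f _) (derive1n 2 f _) => r d dd r0.
rewrite -raddfN det_diag big_ord_recl big_ord1 !mxE /=.
by field; rewrite z0 r0.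
Qed.

(** * The trigonometric rigidity argument and the conclusion *)

(** Comparing t = 0 with pi, and pi/2 with -pi/2, gives a e = b e = 0, which settles e != 0. If e =
    0, then a^2 = b^2 = C, while comparing pi/4 with -pi/4 gives a b = 0, so C = 0, a
    contradiction. *)
Lemma trig_sqr_cst (R : realType) (a b e C : R) : C != 0 ->
    (forall t, (a * cos t + b * sin t - e) ^+ 2 = C) ->
  a = 0 /\ b = 0.
Proof.
move=> C0 h.
have h0 := h 0; have h1 := h (pi / 2); have h2 := h pi.
have h3 := h (- (pi / 2)).
rewrite cos0 sin0 in h0; rewrite cos_pihalf sin_pihalf in h1.
rewrite cospi sinpi in h2; rewrite cosN sinN cos_pihalf sin_pihalf in h3.
have ae : a * e = 0 by lra.
have be : b * e = 0 by lra.
have [e0|e0] := eqVneq e 0; last first.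
  by split; [apply: (mulIf e0)|apply: (mulIf e0)]; rewrite mul0r.
have h4 := h (pi / 4); have h5 := h (- (pi / 4)).
have pi4 : pi / 4 *+ 2 = pi / 2 :> R by field.
have c2 := cos_mulr2n (pi / 4 : R); have s2 := sin_mulr2n (pi / 4 : R).
rewrite pi4 cos_pihalf in c2; rewrite pi4 sin_pihalf in s2.
rewrite cosN sinN in h5.
set c := cos _ in h4 h5 c2 s2; set s := sin _ in h4 h5 s2.
rewrite e0 in h0 h1 h4 h5.
have ab : a * b = 0.
  have : a * b * (c * s *+ 2) = 0 by lra.
  by rewrite -s2 mulr1.
have aa : a ^+ 2 = b ^+ 2 by lra.
case/eqP: C0; rewrite -h0.
move/eqP: ab; rewrite mulf_eq0 => /orP[] /eqP z0.
  by rewrite z0; ring.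
by move: aa; rewrite z0 => aa; lra.
Qed.

Theorem proposition3p1 (R : realType) (alpha : R) (v : 'rV[R]_3)
    (L : 'M[R]_3) (b : 'rV[R]_3) (I : set R) (f : R -> R)
    (halpha : alpha != 0)
    (hL : linear_isometry L)
    (I_open : open I) (I_itv : is_interval I) (I_neq0 : I !=set0)
    (I_gt0 : forall r, I r -> 0 < r)
    (f_smooth : smooth_on I f)
    (hspacelike : spacelike (revolution L b f) (revolution_domain I))
    (htranslator :
       K_translator alpha v (revolution L b f) (revolution_domain I)) :
  parallel v (revolution_axis L b).
Proof.
case: htranslator => N hN hK; have Lu := linear_isometry_unit _ _ hL.
have I0 r : I r -> r != 0 by move=> /I_gt0; exact: lt0r_neq0.
have [r Ir] := I_neq0.
(* The points [p t] run along one parallel of the surface, at fixed radius [r]. *)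
pose p t : 'rV[R]_2 := \row_k [:: r; t]`_k.
have p0 t : p t 0 0 = r by rewrite mxE.
have p1 t : p t 0 1 = t by rewrite mxE.
have Ip t : I (p t 0 0) by rewrite p0.
(* [u] is the speed seen in the frame where the axis is vertical. *)
pose u := v *m invmx L.
have vE : v = u *m L by rewrite mulmxKV.
clearbody u.
set d := derive1 f r.
pose K := - (d * derive1n 2 f r / (r * (1 - d ^+ 2) ^+ 2)).
have KE t : gauss_curvature (revolution L b f) N (p t) = K.
  by rewrite (gauss_curvature_revolution _ _ _ _ _ _ _ hL hN I_open) ?p0.
have K0 : 0 < K by have [+ _] := hK _ (Ip 0); rewrite KE.
have d0 : d != 0.
  by apply: contraTneq K0 => d0; rewrite /K d0 !mul0r oppr0 ltxx.
(* As <N, v> = z (f' (u_1 cos t + u_2 sin t) - u_3), squaring the translator equation and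
   multiplying by 1 - f'^2 = 1 / z^2 removes z. *)
have trig t : (d * u 0 0 * cos t + d * u 0 1 * sin t - u 0 2) ^+ 2 =
    (K `^ alpha) ^+ 2 * (1 - d ^+ 2).
  have dr : derivable f (p t 0 0) 1 := f_smooth 0%N _ (Ip t).
  have [n0 n1 n2] :=
    revolution_normal _ _ _ _ _ _ _ hL hN (Ip t) (I0 _ (Ip t)) dr.
  have [_ ] := hK _ (Ip t); rewrite KE => ->.
  have -> : N (p t) = N (p t) *m invmx L *m L by rewrite mulmxKV.
  rewrite vE hL /lorentz n0 n1; move: n2; rewrite p0 p1 -/d.
  move: ((_ *m _) 0 2) => z z2.
  have -> : (d * u 0 0 * cos t + d * u 0 1 * sin t - u 0 2) ^+ 2 =
      (d * u 0 0 * cos t + d * u 0 1 * sin t - u 0 2) ^+ 2 *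
      (z ^+ 2 * (1 - d ^+ 2)) by rewrite z2 mulr1.
  by ring.
(* Otherwise the denominator of [K] is zero and, the inverse of 0 being 0, [K] would vanish. *)
have d1 : 1 - d ^+ 2 != 0.
  apply: contraTneq K0 => d1.
  by rewrite /K d1 expr0n mulr0 invr0 mulr0 oppr0 ltxx.
have C0 : (K `^ alpha) ^+ 2 * (1 - d ^+ 2) != 0.
  by rewrite mulf_neq0 // expf_neq0 // gt_eqF // powR_gt0.
have [/eqP + /eqP] := trig_sqr_cst _ _ _ _ _ C0 trig.
rewrite !mulf_eq0 (negPf d0) /= => /eqP u0 /eqP u1.
move=> _ _ [s _ <-] [t _ <-] st.
have ts : t - s != 0.
  by apply: contraNneq st => /subr0_eq ->.
(* The two axis points differ by t - s times the image under [L] of the vertical unit vector, and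
   [v] is [u 0 2] times that image. *)
exists (u 0 2 / (t - s)).
rewrite opprD addrACA subrr addr0 -mulmxBl vE scalemxAl; congr (_ *m L).
apply/rowP => j; case: (ord3P j) => ->; rewrite !mxE /= ?u0 ?u1.
- by rewrite subrr mulr0.
- by rewrite subrr mulr0.
- by rewrite divfK.
Qed.
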